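(* Let $(W,S)$ be a Coxeter system with $S$ finite, suppose that $W$ is finite, and let $m$ be the length of the unique element of longest length in $W$. Then $$\sum_{T\subseteq S}\frac{(-1)^{|T|}}{W_T(t)}=\frac{t^m}{W(t)}$$ as an identity of formal power series in $t$.
   Context: A Coxeter system $(W,S)$: $W$ is the group generated by the finite set $S$ subject to the relations $(st)^{m_{st}}=1$ for $s,t\in S$, where $m_{ss}=1$ and, for $s\neq t$, $m_{st}=m_{ts}\in\{2,3,\ldots,\infty\}$ ($m_{st}=\infty$ means no relation). For $w\in W$, $\ell(w)$ denotes the word length of $w$ with respect to $S$. A finite Coxeter group has a unique element of maximal length. For $T\subseteq S$, $W_T$ is the subgroup of $W$ generated by $T$ (so $W_\emptyset=\{1\}$ and $W_S=W$); it is a Coxeter group with generating set $T$, and its word length with respect to $T$ is the restriction of $\ell$. The growth series of $W_T$ is the formal power series $W_T(t)=\sum_{w\in W_T}t^{\ell(w)}$ (in particular $W(t)=\sum_{w\in W}t^{\ell(w)}$); it has constant term $1$, hence is invertible in $\mathbb{Z}[[t]]$. *)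

(* Defs.v *)
From HB Require Import structures.
From mathcomp Require Import all_boot all_fingroup all_algebra.
From mathcomp Require Import boolp.

Set Implicit Arguments.
Unset Strict Implicit.
Unset Printing Implicit Defensive.

Import GRing.Theory.

Local Open Scope ring_scope.

(** * Formal power series *)

(* [FPS a] is the series [\sum_n a n * t^n]. The record keeps [R[[t]]] apart
   from the function type [nat -> R] and its pointwise operations. *)
Record fps (R : Type) := FPS { fps_coef : nat -> R }.

Lemma fpsP (R : Type) (a b : fps R) : fps_coef a =1 fps_coef b <-> a = b.
Proof. by case: a => a; case: b => b; split=> [/funext /= ->|[->]]. Qed.

HB.instance Definition _ (R : Type) := gen_eqMixin (fps R).
HB.instance Definition _ (R : Type) := gen_choiceMixin (fps R).

Section FpsRing.
Variable R : comUnitRingType.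
Implicit Types a b c : fps R.

Definition fps_zero : fps R := FPS (fun=> 0).
Definition fps_opp a := FPS (fun n => - fps_coef a n).
Definition fps_add a b := FPS (fun n => fps_coef a n + fps_coef b n).
Definition fps_one : fps R := FPS (fun n => (n == 0)%N%:R).
Definition fps_mul a b :=
  FPS (fun n => \sum_(i < n.+1) fps_coef a i * fps_coef b (n - i)).

Fact fps_addA : associative fps_add.
Proof. by move=> a b c; apply/fpsP => n /=; rewrite addrA. Qed.
Fact fps_addC : commutative fps_add.
Proof. by move=> a b; apply/fpsP => n /=; rewrite addrC. Qed.
Fact fps_add0 : left_id fps_zero fps_add.
Proof. by move=> a; apply/fpsP => n /=; rewrite add0r. Qed.
Fact fps_addN : left_inverse fps_zero fps_opp fps_add.
Proof. by move=> a; apply/fpsP => n /=; rewrite addNr. Qed.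

HB.instance Definition _ :=
  GRing.isZmodule.Build (fps R) fps_addA fps_addC fps_add0 fps_addN.

Definition fps_trunc n a : {poly R} := \poly_(i < n.+1) fps_coef a i.

Lemma coef_fps_trunc n a i : (i <= n)%N -> (fps_trunc n a)`_i = fps_coef a i.
Proof. by move=> le_in; rewrite coef_poly ltnS le_in. Qed.

Lemma fps_mul_trunc n k a b : (k <= n)%N ->
  fps_coef (fps_mul a b) k = (fps_trunc n a * fps_trunc n b)`_k.
Proof.
move=> le_kn; rewrite coefM /=; apply: eq_bigr => i _.
rewrite !coef_fps_trunc //; first exact: leq_trans (leq_subr _ _) le_kn.
by apply: leq_trans le_kn; rewrite -ltnS.
Qed.

Fact fps_mulA : associative fps_mul.
Proof.
move=> a b c; apply/fpsP => n.
transitivity (fps_trunc n a * (fps_trunc n b * fps_trunc n c))`_n.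
  rewrite coefM /=; apply: eq_bigr => i _.
  rewrite coef_fps_trunc; last by rewrite -ltnS.
  by congr (_ * _); apply: fps_mul_trunc (leq_subr _ _).
rewrite mulrA coefM /=; apply: eq_bigr => i _.
rewrite (coef_fps_trunc _ (leq_subr _ _)); congr (_ * _).
by apply/esym/fps_mul_trunc; rewrite -ltnS.
Qed.
Fact fps_mulC : commutative fps_mul.
Proof.
move=> a b; apply/fpsP => n.
by rewrite !(@fps_mul_trunc n n) // mulrC.
Qed.
Fact fps_mul1 : left_id fps_one fps_mul.
Proof.
move=> a; apply/fpsP => n /=; rewrite big_ord_recl big1 => [|i _] /=.
  by rewrite mul1r addr0 subn0.
by rewrite mul0r.
Qed.
Fact fps_mulDl : left_distributive fps_mul fps_add.
Proof.
move=> a b c; apply/fpsP => n /=; rewrite -big_split /=.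
by apply: eq_bigr => i _; rewrite mulrDl.
Qed.
Fact fps_one_neq0 : fps_one != fps_zero.
Proof.
apply/eqP => /fpsP /(_ 0%N) /= /eqP.
by rewrite oner_eq0.
Qed.

HB.instance Definition _ := GRing.Zmodule_isComNzRing.Build (fps R)
  fps_mulA fps_mulC fps_mul1 fps_mulDl fps_one_neq0.

Definition fps_unit : {pred fps R} := fun a => fps_coef a 0 \is a GRing.unit.

(* The first [n] coefficients of the inverse of [a], from the recursion
   [b_0 = a_0^-1] and [b_n = - a_0^-1 * \sum_(1 <= i <= n) a_i b_(n - i)]. *)
Fixpoint fps_inv_seq a n : seq R :=
  if n is n'.+1 then
    let s := fps_inv_seq a n' in
    rcons s ((fps_coef a 0)^-1 *
             ((n' == 0)%N%:R - \sum_(i < n') fps_coef a i.+1 * s`_(n' - i.+1)))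
  else [::].

Definition fps_inv a :=
  if a \in fps_unit then FPS (fun n => (fps_inv_seq a n.+1)`_n) else a.

Lemma size_fps_inv_seq a n : size (fps_inv_seq a n) = n.
Proof. by elim: n => //= n IHn; rewrite size_rcons IHn. Qed.

Lemma nth_fps_inv_seq a n k : (k < n)%N ->
  (fps_inv_seq a n)`_k = (fps_inv_seq a k.+1)`_k.
Proof.
elim: n => // n IHn; rewrite ltnS leq_eqVlt => /predU1P[-> //|lt_kn].
by rewrite -IHn //= nth_rcons size_fps_inv_seq lt_kn.
Qed.

Fact fps_mulVx : {in fps_unit, left_inverse 1 fps_inv *%R}.
Proof.
move=> a Ua; rewrite mulrC /fps_inv Ua; apply/fpsP => n.
rewrite [LHS]big_ord_recl subn0.
rewrite {1}/fps_coef /= nth_rcons size_fps_inv_seq ltnn eqxx.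
rewrite mulVKr //; set s1 := (X in _ - X + _); set s2 := (X in _ + X).
suff -> : s2 = s1 by rewrite subrK.
apply: eq_bigr => i _; congr (_ * _); apply/esym/nth_fps_inv_seq.
by rewrite ltn_subrL (leq_ltn_trans _ (ltn_ord i)).
Qed.
Fact fps_unitPl a b : b * a = 1 -> fps_unit a.
Proof.
move=> /fpsP /(_ 0%N) /=; rewrite big_ord_recl big_ord0 addr0 subn0 /= => ba1.
by apply/unitrPr; exists (fps_coef b 0); rewrite mulrC.
Qed.
Fact fps_inv_out : {in [predC fps_unit], fps_inv =1 id}.
Proof. by move=> a; rewrite inE /= /fps_inv => /negPf ->. Qed.

HB.instance Definition _ := GRing.ComNzRing_hasMulInverse.Build (fps R)
  fps_mulVx fps_unitPl fps_inv_out.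

Lemma fps_unitE a : (a \is a GRing.unit) = (fps_coef a 0 \is a GRing.unit).
Proof. by []. Qed.

Definition fpsX : fps R := FPS (fun n => (n == 1)%N%:R).

Lemma fps_coef_sum (I : Type) (r : seq I) (P : pred I) (F : I -> fps R) n :
  fps_coef (\sum_(i <- r | P i) F i) n = \sum_(i <- r | P i) fps_coef (F i) n.
Proof. by elim/big_rec2: _ => // i x y _ <-. Qed.

Lemma fps_coefXn k n : fps_coef (fpsX ^+ k) n = (n == k)%:R.
Proof.
elim: k n => [|k IHk] n; first by rewrite expr0.
rewrite exprS [LHS]big_ord_recl /= mul0r add0r.
case: n => [|n]; first by rewrite big_ord0.
rewrite big_ord_recl big1 => [|i _] /=; last by rewrite mul0r.
by rewrite mul1r addr0 subSS subn0 IHk eqSS.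
Qed.

End FpsRing.

Arguments fpsX {R}.

(** * Coxeter systems *)

(* [None] stands for the entry infinity. *)
Record coxeter_matrix (S : Type) := CoxeterMatrix {
  cox_entry :> S -> S -> option nat;
  cox_entry_diag : forall s, cox_entry s s = Some 1%N;
  cox_entry_sym : forall s t, cox_entry s t = cox_entry t s;
  cox_entry_offdiag : forall s t k, s <> t -> cox_entry s t = Some k -> (2 <= k)%N
}.

Definition coxeter_relations (S : Type) (m : coxeter_matrix S) (G : groupType)
    (f : S -> G) : Prop :=
  forall s t k, m s t = Some k -> ((f s * f t) ^+ k = 1)%g.

(* The last three fields say that [W] is the group presented by the generators
   [S] and the Coxeter relations; the group [G] in the universal property is
   not assumed finite. *)
Record coxeter_system (W : finGroupType) (S : finType) := CoxeterSystem {
  cox_mx : coxeter_matrix S;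
  cox_gen : S -> W;
  cox_gen_relations : coxeter_relations cox_mx cox_gen;
  cox_generated : <<[set cox_gen s | s : S]>>%g = [set: W];
  cox_universal : forall (G : groupType) (f : S -> G),
    coxeter_relations cox_mx f ->
    exists phi : {multiplicative W -> G}, forall s, phi (cox_gen s) = f s
}.

Section CoxeterTheory.
Variables (W : finGroupType) (S : finType) (C : coxeter_system W S).

(* Words use only the letters [S], because each generator is an involution:
   [m s s = 1]. *)
Definition cox_has_word (w : W) (n : nat) : bool :=
  [exists u : n.-tuple S, w == (\prod_(s <- u) cox_gen C s)%g].

Lemma cox_has_wordP w : exists n, cox_has_word w n.
Proof.
have /gen_prodgP[n [c cP ->]] : w \in <<[set cox_gen C s | s : S]>>%g.
  by rewrite cox_generated inE.
have {}cP i : exists s, c i == cox_gen C s.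
  by have /imsetP[s _ ->] := cP i; exists s.
exists n; apply/existsP; exists [tuple xchoose (cP i) | i < n].
rewrite big_tuple; apply/eqP; apply: eq_bigr => i _.
by rewrite tnth_mktuple; apply/eqP/(xchooseP (cP i)).
Qed.

Definition cox_length (w : W) : nat := ex_minn (cox_has_wordP w).

Definition cox_parabolic (T : {set S}) : {group W} :=
  <<[set cox_gen C s | s in T]>>%G.

(* A subgroup [W_T] is measured with the length [cox_length] of [W]. *)
Definition growth_series (A : {set W}) : fps int :=
  \sum_(w in A) fpsX ^+ cox_length w.

Lemma cox_length_eq0 w : (cox_length w == 0)%N = (w == 1%g).
Proof.
rewrite /cox_length; case: ex_minnP => n /existsP[u /eqP def_w] min_n.
apply/eqP/eqP => [n0|w1].
  by move: u def_w; rewrite n0 => u ->; rewrite tuple0 big_nil.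
apply/eqP; rewrite -leqn0 min_n //; apply/existsP; exists [tuple].
by rewrite w1 big_nil.
Qed.

Lemma growth_series_coef (A : {set W}) n :
  fps_coef (growth_series A) n = #|[set w in A | cox_length w == n]|%:Z.
Proof.
rewrite fps_coef_sum (eq_bigr _ (fun w _ => fps_coefXn int _ _)).
rewrite -natr_sum natz -sum1_card; congr Posz.
rewrite [RHS](eq_bigl (fun w => (w \in A) && (cox_length w == n))); last first.
  by move=> w; rewrite inE.
by rewrite [RHS]big_mkcondr; apply: eq_bigr => w _; rewrite eq_sym; case: eqP.
Qed.

Lemma growth_series_coef0 (G : {group W}) : fps_coef (growth_series G) 0 = 1.
Proof.
rewrite growth_series_coef -[1]/(1%:Z); congr Posz.
apply: etrans (cards1 (1%g : W)); apply: eq_card => w.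
by rewrite !inE cox_length_eq0 andb_idl // => /eqP ->.
Qed.

Lemma growth_series_unit (G : {group W}) : growth_series G \is a GRing.unit.
Proof.
by rewrite fps_unitE growth_series_coef0.
Qed.

End CoxeterTheory.

(* Main.v *)
(* The series [W(t) / W_T(t)] counts by length the elements with no left
   descent in [T]: these are the shortest representatives of the cosets [W_T w].
   Exchanging the sums, [\sum_T (-1)^|T| W(t) / W_T(t)] counts each [w] with the
   weight [\sum_(T disjoint from the descents of w) (-1)^|T|], which vanishes
   unless all generators are descents of [w], i.e. unless [w] is the longest
   element.
   The facts about lengths come from the inversion sets [N(w)], a subset of [W]
   subject to [N(u v) = N(u) + u N(v) u^-1] (symmetric difference) and
   [N(s) = {s}]. They satisfy [#|N(w)| = l(w)], and [r \in N(w)] implies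
   [l(r w) < l(w)]. *)

Require Import Defs.
From mathcomp Require Import all_boot all_fingroup all_algebra.

Import GRing.Theory.
Local Open Scope ring_scope.

Section Inversions.
Set Implicit Arguments.
Unset Strict Implicit.
Variables (W : finGroupType) (S : finType) (C : coxeter_system W S).
Implicit Types (w u v r : W) (s t : S) (a b : seq S) (T : {set S}).
Local Open Scope group_scope.

Local Notation gen := (cox_gen C).
Local Notation len := (cox_length C).
Local Notation word a := (\prod_(s <- a) gen s).
Local Notation parabolic := (cox_parabolic C).

(** * Crossing parities and the action on [W * bool] *)

Lemma gen_sqr s : gen s * gen s = 1.
Proof. exact: cox_gen_relations (cox_entry_diag (cox_mx C) s). Qed.

Lemma genV s : (gen s)^-1 = gen s.
Proof. by apply/eqP; rewrite eq_invg_mul gen_sqr. Qed.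

Lemma genKg s w : gen s * (gen s * w) = w.
Proof. by rewrite mulgA gen_sqr mul1g. Qed.

Lemma gen_conj s : gen s ^ gen s = gen s.
Proof. by rewrite conjgE mulgA mulVg mul1g. Qed.

(** Conjugation by [gen s] inverts [gen s * gen t], so moving [gen s] past the inverse power doubles
    the exponent. *)
Lemma gen_conjXV s t n :
  gen s ^ ((gen s * gen t) ^+ n)^-1 = (gen s * gen t) ^+ (n + n) * gen s.
Proof.
have /(congr1 (fun w => w ^+ n)) : (gen s * gen t) ^ gen s = (gen s * gen t)^-1.
  by rewrite conjgE invMg !genV !mulgA gen_sqr mul1g.
rewrite -conjXg expVgn => E.
by rewrite conjgE invgK expgD -!mulgA -E conjgE genV genKg.
Qed.

(* As [s] runs over the generators, these permutations of [W * bool] satisfy the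
   Coxeter relations; the boolean records the parity of the crossings of the
   first component, following Bourbaki. *)
Definition reflect_fun s (x : W * bool) : W * bool :=
  (x.1 ^ gen s, x.2 (+) (x.1 == gen s)).

Lemma reflect_funK s : involutive (reflect_fun s).
Proof.
case=> r e; rewrite /reflect_fun /= -conjgM gen_sqr conjg1.
by rewrite -addbA -{3}gen_conj (inj_eq (conjg_inj _)) addbb addbF.
Qed.

Definition reflect_perm s : {perm W * bool} := perm (inv_inj (reflect_funK s)).

Lemma reflect_permX s t n (r : W) (e : bool) :
  ((reflect_perm s * reflect_perm t) ^+ n) (r, e)
    = (r ^ ((gen s * gen t) ^+ n),
       e (+) odd (\sum_(j < n.*2) (r == ((gen s * gen t) ^+ j * gen s)%g))).
Proof.
elim: n => [|n IHn].
  by rewrite expg0 perm1 big_ord0 addbF expg0 conjg1.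
rewrite expgSr !permM {}IHn !permE /reflect_fun /=.
set p := gen s * gen t; congr (_, _); first by rewrite -!conjgM expgSr.
have E x : (r ^ (p ^+ n) == x) = (r == x ^ (p ^+ n)^-1).
  by rewrite -[in RHS](inj_eq (conjg_inj (p ^+ n))) conjgKV.
have -> : ((r ^ (p ^+ n)) ^ gen s == gen t) = (r ^ (p ^+ n) == p * gen s).
  rewrite -(inj_eq (conjg_inj (gen s)) _ (p * _)); congr (_ == _).
  by rewrite conjgE genV /p -!mulgA gen_sqr mulg1 genKg.
(* The two new letters give the terms [2n] and [2n + 1]: [gen s] and [p * gen s], conjugated back by
   [p ^+ n]. *)
rewrite doubleS !big_ord_recr /= !oddD !oddb -!addbA.
congr (_ (+) (_ (+) (_ (+) _))); rewrite E.
  by rewrite (gen_conjXV s t) addnn.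
rewrite conjMg conjgE invgK.
have -> : p ^+ n * (p * (p ^+ n)^-1) = p by rewrite mulgA -expgSr expgS mulgK.
by rewrite (gen_conjXV s t) addnn mulgA -expgS.
Qed.

(** The [2k] reflections counted repeat with period [k], so each is met an even number of times. *)
Lemma reflect_perm_relations : coxeter_relations (cox_mx C) reflect_perm.
Proof.
move=> s t k /(cox_gen_relations (c := C)) pk1; apply/permP => -[r e].
rewrite reflect_permX pk1 perm1 conjg1 -addnn big_split_ord /= oddD.
set x := \sum_(_ < _) _; set y := \sum_(_ < _) _.
suff -> : y = x by rewrite addbb addbF.
by apply: eq_bigr => j _; rewrite expgD pk1 mul1g.
Qed.

(** For [a = s_1 ... s_n], the parity of the number of [i] with [r = s_1 ... s_i ... s_1]. *)
Fixpoint crosses a r : bool :=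
  if a is s :: a' then (r == gen s) (+) crosses a' (r ^ gen s) else false.

Lemma crosses_cat a b r :
  crosses (a ++ b) r = crosses a r (+) crosses b (r ^ word a).
Proof.
elim: a r => [|s a IHa] r /=; first by rewrite big_nil conjg1.
by rewrite IHa big_cons conjgM addbA.
Qed.

(* Here the presentation of [W] is used: the parity of the number of crossings
   of a word is read off the action of its value on [W * bool]. *)
Lemma eq_crosses a b : word a = word b -> crosses a =1 crosses b.
Proof.
have [phi phiE] := cox_universal reflect_perm_relations.
have phi1 : phi 1 = 1 by apply: (mulgI (phi 1)); rewrite -gmulfM !mulg1.
have phi_word c r e : phi (word c) (r, e) = (r ^ word c, e (+) crosses c r).
  elim: c r e => [|s c IHc] r e.
    by rewrite big_nil phi1 perm1 conjg1 addbF.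
  rewrite big_cons gmulfM permM phiE permE /reflect_fun /= IHc conjgM.
  by rewrite addbA.
by move=> eq_ab r; have := phi_word a r false; rewrite eq_ab phi_word => -[].
Qed.

(** * Inversion sets, strong exchange and length *)

Lemma reduced_wordP w : exists a, (w == word a) && (size a == len w).
Proof.
rewrite /cox_length; case: ex_minnP => n /existsP[u /eqP ->] _.
by exists u; rewrite size_tuple !eqxx.
Qed.

Definition reduced_word w : seq S := xchoose (reduced_wordP w).

Lemma reduced_wordE w : word (reduced_word w) = w.
Proof. by have /andP[/eqP<-] := xchooseP (reduced_wordP w). Qed.

Lemma size_reduced_word w : size (reduced_word w) = len w.
Proof. by have /andP[_ /eqP] := xchooseP (reduced_wordP w). Qed.

Lemma len_word a : (len (word a) <= size a)%N.
Proof.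
rewrite /cox_length; case: ex_minnP => n _; apply; apply/existsP.
by exists (in_tuple a).
Qed.

Lemma len_gen_mul s w : (len (gen s * w) <= (len w).+1)%N.
Proof.
have := len_word (s :: reduced_word w).
by rewrite big_cons reduced_wordE /= size_reduced_word.
Qed.

Definition inversions w : {set W} := [set r | crosses (reduced_word w) r].

Lemma mem_inversions_word a r : (r \in inversions (word a)) = crosses a r.
Proof. by rewrite inE (eq_crosses (reduced_wordE _)). Qed.

Lemma mem_inversionsM u v r :
  (r \in inversions (u * v)) =
    (r \in inversions u) (+) (r ^ u \in inversions v).
Proof.
rewrite -{1 3}[u]reduced_wordE -{1}[v]reduced_wordE -big_cat.
by rewrite mem_inversions_word crosses_cat !inE.
Qed.

Lemma inversions1 : inversions 1 = set0.
Proof.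
apply/setP=> r; have := mem_inversions_word [::] r.
by rewrite big_nil => ->; rewrite inE.
Qed.

Lemma inversions_gen s : inversions (gen s) = [set gen s].
Proof.
apply/setP=> r; have := mem_inversions_word [:: s] r.
by rewrite big_seq1 /= addbF => ->; rewrite inE.
Qed.

Lemma mem_inversionsV w r :
  (r \in inversions w^-1) = (r ^ w^-1 \in inversions w).
Proof.
have := mem_inversionsM w^-1 w r; rewrite mulVg inversions1 inE.
by case: (r \in _); case: (_ \in _).
Qed.

(** The factors [w^-1] and [w] contribute equal parities, which cancel; the middle [gen s]
    contributes 1. *)
Lemma reflection_inversion s w : gen s ^ w \in inversions (gen s ^ w).
Proof.
rewrite {2}conjgE !mem_inversionsM mem_inversionsV inversions_gen.
by rewrite conjgK set11 gen_conj addTb addbN addbb.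
Qed.

(** Left multiplication by [r] deletes a letter at which [r] is crossed. Keeping [b] within the
    letters of [a] makes this usable inside parabolic subgroups. *)
Lemma strong_exchange_word a r : crosses a r ->
  exists b, [/\ {subset b <= a}, (size b < size a)%N & r * word a = word b].
Proof.
elim: a r => [|s a IHa] //= r.
have [-> _|_ /IHa[b [sba lt_ba def_b]]] := eqVneq r (gen s).
  exists a; split=> //; last by rewrite big_cons genKg.
  by move=> x; rewrite inE orbC => ->.
exists (s :: b); split=> //.
  by move=> x; rewrite !inE => /predU1P[->|/sba->]; rewrite ?eqxx ?orbT.
by rewrite !big_cons -def_b conjgE genV !mulgA gen_sqr mul1g.
Qed.

Lemma strong_exchange w r : r \in inversions w -> (len (r * w) < len w)%N.
Proof.
rewrite inE => /strong_exchange_word[b [_ lt_b]].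
rewrite reduced_wordE => ->; rewrite -(size_reduced_word w).
exact: leq_ltn_trans (len_word b) lt_b.
Qed.

Lemma gen_inversion_mul s w :
  (gen s \in inversions (gen s * w)) = (gen s \notin inversions w).
Proof.
by rewrite mem_inversionsM inversions_gen set11 gen_conj addTb.
Qed.

Lemma inversions_gen_mul s w : gen s \notin inversions w ->
  inversions (gen s * w) = gen s |: inversions w :^ gen s.
Proof.
move=> nsw; apply/setP=> r.
rewrite mem_inversionsM inversions_gen in_setU1 in_set1 mem_conjg genV.
have [->|//] := eqVneq r (gen s).
by rewrite gen_conj (negPf nsw).
Qed.

(** The first letter of a reduced word adds exactly one inversion: by strong exchange it is not
    already an inversion of the rest. *)
Lemma card_inversions w : #|inversions w| = len w.
Proof.
move Dn: (len w) => n; elim: n w Dn => [|n IHn] w.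
  by move/eqP; rewrite cox_length_eq0 => /eqP->; rewrite inversions1 cards0.
move=> len_w; have := size_reduced_word w; have := reduced_wordE w.
case: (reduced_word w) => [|s a]; rewrite len_w //= => def_w [sza].
rewrite -{w}def_w big_cons in len_w *.
set v := word a in len_w *; have le_vn: (len v <= n)%N by rewrite -sza len_word.
have nsv : gen s \notin inversions v.
  apply/negP=> /strong_exchange; rewrite len_w ltnNge.
  by rewrite (leq_trans le_vn).
have len_v : len v = n.
  by apply/eqP; rewrite eqn_leq le_vn -ltnS -len_w len_gen_mul.
rewrite inversions_gen_mul // cardsU1 mem_conjg genV gen_conj nsv.
by rewrite cardJg IHn.
Qed.

(** * Parabolic subgroups and minimal coset representatives *)

Lemma parabolic_word T v : v \in parabolic T ->
  exists2 a, {subset a <= T} & v = word a.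
Proof.
case/gen_prodgP=> n [c cT ->].
have {}cT i : exists s, (s \in T) && (c i == gen s).
  by have /imsetP[s sT ->] := cT i; exists s; rewrite sT eqxx.
exists (val [tuple xchoose (cT i) | i < n]).
  move=> _ /tnthP[i ->]; rewrite tnth_mktuple.
  by have /andP[] := xchooseP (cT i).
rewrite big_tuple; apply: eq_bigr => i _; rewrite tnth_mktuple.
by have /andP[_ /eqP] := xchooseP (cT i).
Qed.

Lemma gen_parabolic T s : s \in T -> gen s \in parabolic T.
Proof. by move=> sT; rewrite mem_gen // imset_f. Qed.

Lemma sub_inversions_parabolic T v :
  v \in parabolic T -> inversions v \subset parabolic T.
Proof.
case/parabolic_word=> a aT ->; apply/subsetP=> r.
rewrite mem_inversions_word; elim: a aT r => //= s a IHa aT r.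
have /gen_parabolic sT: s \in T by rewrite aT ?mem_head.
have [-> //|_ /IHa] := eqVneq r (gen s).
by rewrite groupJr //; apply=> x xa; rewrite aT // inE xa orbT.
Qed.

Definition left_descents w : {set S} := [set s | gen s \in inversions w].

(** If the first letter of a word over [T] is not a descent, it is an inversion of the remaining
    word, and exchange gives a shorter word over [T] for the same element. *)
Lemma parabolic_descent T v : v \in parabolic T -> v != 1 ->
  exists2 s, s \in T & s \in left_descents v.
Proof.
case/parabolic_word=> a aT ->; elim: {a}(size a) {-2}a (leqnn (size a)) aT.
  by case=> // _ _; rewrite big_nil eqxx.
move=> n IHn [|s a] /=; first by rewrite big_nil eqxx.
rewrite ltnS => le_an aT; have sT : s \in T by rewrite aT ?mem_head.
rewrite big_cons => sa_neq1.
have [ds|] := boolP (s \in left_descents (gen s * word a)).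
  by exists s.
rewrite inE gen_inversion_mul negbK mem_inversions_word.
case/strong_exchange_word=> b [sba lt_ba def_b]; move: sa_neq1.
rewrite def_b; apply: IHn => [|x /sba xa].
  exact: leq_trans (ltnW lt_ba) le_an.
by rewrite aT // inE xa orbT.
Qed.

Definition coset_minimal T : {set W} :=
  [set u | [disjoint T & left_descents u]].

Lemma parabolic_coset_decomp T w :
  exists v u,
    [/\ v \in parabolic T, [disjoint inversions u & parabolic T] & w = v * u].
Proof.
(* [x * w] is shortest in its coset; an inversion [r] in the subgroup would make [r * x * w]
   shorter. *)
have [x xT min_x] := arg_minnP (fun x => len (x * w)) (group1 (parabolic T)).
exists x^-1, (x * w); rewrite groupV mulKg; split=> //.
apply/pred0P=> r /=; apply/negP=> /andP[/strong_exchange].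
by rewrite mulgA ltnNge => /negP lt_r rT; apply/lt_r/min_x/groupM.
Qed.

Lemma mem_inversions_parabolicM T v u r :
    v \in parabolic T -> [disjoint inversions u & parabolic T] ->
    r \in parabolic T ->
  (r \in inversions (v * u)) = (r \in inversions v).
Proof.
move=> vT /pred0P dis_u rT; rewrite mem_inversionsM.
by have /= := dis_u (r ^ v); rewrite groupJ // andbT => ->; rewrite addbF.
Qed.

(** In the decomposition [u = v * u'], a nontrivial [v] would have a descent in [T], which [u] would
    inherit; so [u = u']. *)
Lemma coset_minimalE T u :
  (u \in coset_minimal T) = [disjoint inversions u & parabolic T].
Proof.
rewrite inE; apply/idP/idP => [dis_u|/pred0P dis_u]; last first.
  apply/pred0P=> s /=; apply/negP=> /andP[/gen_parabolic sT]; rewrite inE => su.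
  by have := dis_u (gen s); rewrite /= su sT.
have [v [u' [vT dis_u' def_u]]] := parabolic_coset_decomp T u.
suff /eqP v1 : v == 1 by rewrite def_u v1 mul1g.
apply/idPn=> /(parabolic_descent vT)[s sT]; rewrite inE => sv.
have /pred0P/(_ s) := dis_u; rewrite /= sT inE def_u.
by rewrite (mem_inversions_parabolicM vT dis_u') ?gen_parabolic ?sv.
Qed.

(** If [v * u = v' * u'], a nontrivial [x = v^-1 * v'] would have a descent in [T], inherited by
    [u = x * u']. *)
Lemma parabolic_mul_inj T :
  {in setX (parabolic T) (coset_minimal T) &, injective (fun x => x.1 * x.2)}.
Proof.
move=> [v u] [v' u']; rewrite !in_setX /= !coset_minimalE.
case/andP=> vT dis_u /andP[v'T dis_u'] eq_vu.
suff eq_v : v = v' by move: eq_vu; rewrite eq_v => /mulgI->.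
apply/eqP; rewrite eq_mulVg1; apply/idPn=> x_neq1.
have xT : v^-1 * v' \in parabolic T by rewrite groupM ?groupV.
have [s /gen_parabolic sT] := parabolic_descent xT x_neq1; rewrite inE.
rewrite -(mem_inversions_parabolicM xT dis_u' sT) -mulgA -eq_vu mulKg => su.
by have /pred0P/(_ (gen s)) := dis_u; rewrite /= su sT.
Qed.

(** The inversions of [v] lie in [W_T]; those of [u], conjugated by [v^-1], avoid it. Hence the
    symmetric difference is a disjoint union. *)
Lemma len_parabolic_mul T v u : v \in parabolic T -> u \in coset_minimal T ->
  len (v * u) = (len v + len u)%N.
Proof.
move=> vT; rewrite coset_minimalE => dis_u.
have dis_vu : inversions v :&: inversions u :^ v^-1 = set0.
  apply/setP=> r; rewrite in_setI mem_conjgV in_set0; apply/negP=> /andP[rv ru].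
  have rT := subsetP (sub_inversions_parabolic vT) r rv.
  by have /pred0P/(_ (r ^ v)) := dis_u; rewrite /= ru groupJ.
rewrite -!card_inversions -(cardJg (inversions u) v^-1) -cardsUI.
rewrite dis_vu cards0 addn0.
apply: eq_card => r; rewrite mem_inversionsM in_setU mem_conjgV.
have /setP/(_ r) := dis_vu; rewrite in_setI mem_conjgV in_set0.
by case: (r \in _); case: (_ \in _).
Qed.

Lemma parabolicT : parabolic [set: S] = [set: W] :> {set W}.
Proof.
rewrite -(cox_generated C) /=; congr <<_>>.
by apply/setP=> w; apply/imsetP/imsetP=> -[s _ ->]; exists s.
Qed.

Lemma growth_parabolic_mul T :
  (growth_series C [set: W]
     = growth_series C (parabolic T) * growth_series C (coset_minimal T))%R.
Proof.
have -> : [set: W] =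
    [set x.1 * x.2 | x in setX (parabolic T) (coset_minimal T)].
  apply/esym/setP=> w; rewrite in_setT; apply/imsetP.
  have [v [u [vT dis_u ->]]] := parabolic_coset_decomp T w.
  by exists (v, u); rewrite // in_setX vT coset_minimalE.
rewrite /growth_series (big_imset _ (@parabolic_mul_inj T)) /= mulr_suml.
under [RHS]eq_bigr do rewrite mulr_sumr.
rewrite pair_big_dep; apply: eq_big => -[v u] /=; rewrite in_setX //.
by case/andP=> vT uT; rewrite (len_parabolic_mul vT uT) exprD.
Qed.

(** * The longest element *)

Section Longest.
Variables (w0 : W) (w0_longest : forall w, (len w <= len w0)%N).

(** A reflection [t] outside [inversions w0] would be an inversion of [t * w0], making
    [w0 = t * (t * w0)] shorter than [t * w0]. *)
Lemma reflection_inversion_longest s w : gen s ^ w \in inversions w0.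
Proof.
set t := gen s ^ w; have tt : t * t = 1 by rewrite -conjMg gen_sqr conj1g.
have := w0_longest (t * w0); rewrite leqNgt; apply: contraNT => nt.
rewrite -{1}[w0]mul1g -tt -mulgA; apply: strong_exchange.
rewrite mem_inversionsM reflection_inversion conjgE mulgA mulVg mul1g.
by rewrite (negPf nt).
Qed.

Lemma left_descents_longest w : (left_descents w == [set: S]) = (w == w0).
Proof.
apply/eqP/eqP=> [desc_w|->]; last first.
  apply/setP=> s.
  by rewrite in_setT inE -[gen s]conjg1 reflection_inversion_longest.
(* A descent of [v = w * w0^-1] is not one of [w = v * w0], as [w0] has every reflection as
   inversion and cancels the parity from [v]. *)
apply/eqP; rewrite eq_mulgV1; apply/idPn=> /(parabolic_descent (T := setT)).
rewrite parabolicT in_setT => /(_ isT)[s _]; rewrite inE => sv.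
have : s \in left_descents w by rewrite desc_w in_setT.
by rewrite inE -[w in inversions w](mulgKV w0) mem_inversionsM sv
  reflection_inversion_longest.
Qed.

End Longest.

End Inversions.

Theorem mainTheorem2 (W : finGroupType) (S : finType) (C : coxeter_system W S)
    (w0 : W) (w0_longest : forall w : W, (cox_length C w <= cox_length C w0)%N) :
  \sum_(T : {set S}) (-1) ^+ #|T| / growth_series C (cox_parabolic C T)
    = fpsX ^+ cox_length C w0 / growth_series C [set: W].
Proof.
have unitW : growth_series C [set: W] \is a GRing.unit.
  by rewrite -(parabolicT C) growth_series_unit.
transitivity (\sum_(T : {set S})
    (-1) ^+ #|T| * growth_series C (coset_minimal C T)
      / growth_series C [set: W]).
  apply: eq_bigr => T _; rewrite -mulrA; congr (_ * _).
  have unitT := growth_series_unit C (cox_parabolic C T).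
  apply: (mulrI unitT); rewrite divrr // mulrA.
  by rewrite -growth_parabolic_mul divrr.
rewrite -mulr_suml; congr (_ / _).
(* The sign times the indicator of disjointness is written as a product over [S], so that the sum
   over [T] factors. *)
transitivity (\sum_(w : W) \sum_(T : {set S})
    fpsX ^+ cox_length C w *
    (\prod_(s : S) if s \in T then - (s \notin left_descents C w)%:R else 1
       : fps int)).
  rewrite exchange_big; apply: eq_bigr => T _.
  rewrite /growth_series mulr_sumr big_mkcond; apply: eq_bigr => w _.
  rewrite -big_mkcond /= mulrC inE.
  have [dis_wT|] := boolP [disjoint T & left_descents C w].
    rewrite (eq_bigr (fun=> -1)) ?prodr_const // => s sT.
    by rewrite (disjointFr dis_wT sT).
  rewrite -setI_eq0 => /set0Pn[s /setIP[sT sw]].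
  by rewrite (bigD1 s) //= sw oppr0 mul0r mulr0.
under eq_bigr do rewrite -mulr_sumr -(bigA_distr 1 +%R _ (fun=> 1)).
(* The factor at [s] is 1 if [s] is a descent of [w] and 0 otherwise; only [w0] has all descents. *)
rewrite (bigD1 w0) //= [X in _ + X]big1 => [|w]; last first.
  rewrite -(left_descents_longest w0_longest) -subTset => /subsetPn[s _ nsw].
  by rewrite (bigD1 s) //= nsw addNr mul0r mulr0.
rewrite addr0 big1 ?mulr1 // => s _.
have /eqP-> : left_descents C w0 == setT
  by rewrite (left_descents_longest w0_longest).
by rewrite in_setT oppr0 add0r.
Qed.
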